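(* Let $X$ be a Hausdorff topological space and $\gamma:2^X\to[0,\infty]$ a measure of noncompactness in $X$. Let $W:X\to2^X$ be a multifunction with nonempty values which is condensing with respect to $\gamma$. Assume that there exists a nonempty closed set $B\subseteq X$ such that $W(B)\subseteq B$ and $\gamma(W(B))<\infty$. Then $W$ admits a nonempty minimal invariant set (a minimal element, with respect to inclusion, among the nonempty invariant sets) which is compact.
   Context: A multifunction is a map $W:X\to2^X$; $W(S)=\bigcup_{x\in S}W(x)$. No continuity is assumed. The Hutchinson operator induced by $W$ is $\mathcal{F}(S)=\overline{W(S)}$, $S\subseteq X$; a set $A\subseteq X$ is invariant if $\mathcal{F}(A)=A$. A measure of noncompactness (MNC) in $X$ is a functional $\gamma:2^X\to[0,\infty]$ such that for all $S,S'\subseteq X$, $x\in X$: $\gamma(\emptyset)=0$; $\gamma(\overline S)=\gamma(S)$; if $\gamma(S)=0$ then $\overline S$ is compact; if $S\subseteq S'$ then $\gamma(S)\le\gamma(S')$; $\gamma(S\cup\{x\})=\gamma(S)$. $W$ is condensing with respect to $\gamma$ if for every $S\subseteq X$: $\gamma(W(S))<\gamma(S)$ when $0<\gamma(S)<\infty$, and $\gamma(W(S))=0$ when $\gamma(S)=0$. *)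

(* Defs.v *)
From HB Require Import structures.
From mathcomp Require Import all_boot all_order all_algebra.
From mathcomp Require Import all_classical all_reals all_analysis.
Set Implicit Arguments.
Unset Strict Implicit.
Unset Printing Implicit Defensive.
Local Open Scope classical_set_scope.
Local Open Scope ereal_scope.

Definition mimage (X : Type) (W : X -> set X) (S : set X) : set X :=
  \bigcup_(x in S) W x.

Definition hutchinson (X : topologicalType) (W : X -> set X) (S : set X) :
  set X := closure (mimage W S).

Definition invariant_set (X : topologicalType) (W : X -> set X) (A : set X) :
  Prop := hutchinson W A = A.

Definition minimal_invariant_set (X : topologicalType) (W : X -> set X)
    (A : set X) : Prop :=
  [/\ A !=set0, invariant_set W A &
      forall C : set X, C !=set0 -> invariant_set W C -> C `<=` A -> C = A].

Record is_mnc (R : realType) (X : topologicalType) (gamma : set X -> \bar R) :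
    Prop := IsMNC {
  mnc_ge0 : forall S, 0 <= gamma S ;
  mnc_set0 : gamma set0 = 0 ;
  mnc_closure : forall S, gamma (closure S) = gamma S ;
  mnc_compact : forall S, gamma S = 0 -> compact (closure S) ;
  mnc_le : forall S T, S `<=` T -> gamma S <= gamma T ;
  mnc_setU1 : forall S x, gamma (S `|` [set x]) = gamma S
}.

Definition condensing (R : realType) (X : Type) (gamma : set X -> \bar R)
    (W : X -> set X) : Prop :=
  forall S : set X,
    (0 < gamma S -> gamma S < +oo -> gamma (mimage W S) < gamma S) /\
    (gamma S = 0 -> gamma (mimage W S) = 0).

(* Main.v *)
Require Import Defs.
From mathcomp Require Import all_boot all_order all_algebra.
From mathcomp Require Import all_classical all_reals all_analysis.
Set Implicit Arguments.
Unset Strict Implicit.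
Unset Printing Implicit Defensive.
Import Order.TTheory.
Local Open Scope classical_set_scope.
Local Open Scope ereal_scope.

(** Fix [x0] in [B] and let [C] be the least closed set containing [x0] with
[W(C) `<=` C].  Then [C] is the union of the closure of [W(C)] and [{x0}], so
[gamma C = gamma (W C)], which for a condensing [W] forces [gamma C = 0]:
[C] is compact.  By Zorn's lemma [C] contains a minimal nonempty closed [A]
with [W(A) `<=` A].  Since the closure of [W(A)] has the same properties and
lies in [A], it equals [A]. *)

(** Weaker than invariance but, unlike it, stable under arbitrary intersections; both the hull of a
    point and the use of Zorn's lemma rest on this. *)
Definition closed_forward (X : topologicalType) (W : X -> set X) (S : set X) :=
  closed S /\ mimage W S `<=` S.

Lemma mimageS (X : Type) (W : X -> set X) (S T : set X) :
  S `<=` T -> mimage W S `<=` mimage W T.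
Proof. by move=> ST y [x Sx Wxy]; exists x => //; exact: ST. Qed.

Lemma closed_forward_bigcap (X : topologicalType) (W : X -> set X)
    (I : Type) (D : set I) (f : I -> set X) :
  (forall i, D i -> closed_forward W (f i)) ->
  closed_forward W (\bigcap_(i in D) f i).
Proof.
move=> Df; split; first by apply: closed_bigI => i /Df[].
move=> y [x fx Wxy] i Di; apply: (Df i Di).2.
by exists x => //; exact: fx.
Qed.

Lemma closed_forward_hutchinsonS (X : topologicalType) (W : X -> set X)
    (S : set X) : closed_forward W S -> hutchinson W S `<=` S.
Proof.
move=> [cS WS]; have := closure_subset WS.
by rewrite -(closure_id S).1.
Qed.

Lemma closed_forward_hutchinson (X : topologicalType) (W : X -> set X)
    (S : set X) : closed_forward W S -> closed_forward W (hutchinson W S).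
Proof.
move=> fS; split; first exact: closed_closure.
apply: (@subset_trans _ (mimage W S)); last exact: subset_closure.
exact: mimageS (closed_forward_hutchinsonS fS).
Qed.

(** Through this inclusion of classes, minimality among nonempty closed forward sets passes to
    minimality among nonempty invariant sets. *)
Lemma invariant_closed_forward (X : topologicalType) (W : X -> set X)
    (S : set X) : invariant_set W S -> closed_forward W S.
Proof.
rewrite /invariant_set => SE; split.
  by rewrite -SE; exact: closed_closure.
by rewrite -{2}SE; exact: subset_closure.
Qed.

Lemma hutchinson_nonempty (X : topologicalType) (W : X -> set X) (S : set X) :
  (forall x, W x !=set0) -> S !=set0 -> hutchinson W S !=set0.
Proof.
move=> W0 [x Sx]; have [y Wxy] := W0 x.
by exists y; apply: subset_closure; exists x.
Qed.

(** The members of the chain form a base of a proper filter containing [K]. A cluster point of this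
    filter adheres to every [f i], hence lies in it by closedness. *)
Lemma compact_chain_bigcap_nonempty (X : topologicalType) (K : set X)
    (I : Type) (D : set I) (f : I -> set X) :
  compact K -> D !=set0 ->
  (forall i, D i -> [/\ closed (f i), f i `<=` K & f i !=set0]) ->
  (forall i j, D i -> D j -> f i `<=` f j \/ f j `<=` f i) ->
  \bigcap_(i in D) f i !=set0.
Proof.
move=> cK [i0 Di0] Df tot.
have FF : ProperFilter (filter_from D f).
  apply: filter_from_proper => [|i /Df[]//].
  apply: filter_from_filter; first by exists i0.
  move=> i j Di Dj; case: (tot i j Di Dj) => le.
    by exists i => // x fx; split => //; exact: le.
  by exists j => // x fx; split => //; exact: le.
have [] := cK (filter_from D f) FF.
  by exists i0 => //; case: (Df _ Di0).
move=> p [_ clp]; exists p => i Di.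
have [cfi _ _] := Df _ Di.
by apply: cfi => V Vp; apply: clp => //; exists i.
Qed.

Lemma compact_minimal_closed_forward (X : topologicalType) (W : X -> set X)
    (K : set X) : compact K -> closed_forward W K -> K !=set0 ->
  exists A, [/\ A `<=` K, A !=set0, closed_forward W A &
    forall C, C !=set0 -> closed_forward W C -> C `<=` A -> C = A].
Proof.
move=> cK fK K0.
pose P A := K `\` A !=set0 /\ closed_forward W (K `\` A).
(* [Zorn_bigcup] yields maximal elements, hence the passage to complements. *)
have [|A [[M0 fM] Amax]] := @Zorn_bigcup X P.
  (* The empty chain is treated apart: its union has complement [K] in [K], whereas the empty
     intersection is the whole space. *)
  move=> F FP Ftot; have [->|F0] := eqVneq F set0.
    by rewrite /P bigcup_set0 setD0.
  rewrite /P; have -> : K `\` \bigcup_(A in F) A = \bigcap_(A in F) (K `\` A).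
    apply/seteqP; split => [x [Kx nx] A FA|x fx].
      by split => // Ax; apply: nx; exists A.
    have /set0P[A0 FA0] := F0.
    by have [Kx _] := fx _ FA0; split => // -[A /fx[]].
  split; last by apply: closed_forward_bigcap => A /FP[].
  apply: (compact_chain_bigcap_nonempty (K := K)) => //; first exact/set0P.
    by move=> A /FP[? []]; split => // x [].
  by move=> A B FA FB; case: (Ftot _ _ FA FB) => le; [right|left];
    apply: setDS.
exists (K `\` A); split => // C C0 fC CM.
apply: contrapT => CneM; apply: (Amax (~` C)).
  split; first by move=> x Ax Cx; case: (CM _ Cx).
  move=> CA; apply: CneM; apply/seteqP; split => // x [Kx nAx].
  by apply: contrapT => /CA.
rewrite /P setDE setCK (_ : K `&` C = C)//.
by apply/seteqP; split => [x []//|x Cx]; split => //; case: (CM _ Cx).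
Qed.

Lemma minimal_closed_forward_invariant (X : topologicalType) (W : X -> set X)
    (A : set X) : (forall x, W x !=set0) -> A !=set0 -> closed_forward W A ->
  (forall C, C !=set0 -> closed_forward W C -> C `<=` A -> C = A) ->
  minimal_invariant_set W A.
Proof.
move=> W0 A0 fA Amin; split => // [|C C0 /invariant_closed_forward fC].
  apply: Amin; first exact: hutchinson_nonempty.
    exact: closed_forward_hutchinson.
  exact: closed_forward_hutchinsonS.
exact: Amin.
Qed.

Definition forward_hull (X : topologicalType) (W : X -> set X) (x : X) :=
  \bigcap_(S in [set S | closed_forward W S /\ S x]) S.

Lemma forward_hull_closed_forward (X : topologicalType) (W : X -> set X)
    (x : X) : closed_forward W (forward_hull W x).
Proof. by apply: closed_forward_bigcap => S []. Qed.

Lemma forward_hull_id (X : topologicalType) (W : X -> set X) (x : X) :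
  forward_hull W x x.
Proof. by move=> S []. Qed.

(** The right-hand side [D] lies in the hull [C], so [W(D)] lies in [W(C)] and thus in [D]. As
    points are closed, [D] is one of the sets intersected to form [C], which gives the other
    inclusion. *)
Lemma forward_hull_eq (X : topologicalType) (W : X -> set X) (x : X) :
  hausdorff_space X ->
  forward_hull W x = hutchinson W (forward_hull W x) `|` [set x].
Proof.
move=> hX; set C := forward_hull W x; set D := _ `|` _.
have fC : closed_forward W C := forward_hull_closed_forward W x.
have DC : D `<=` C.
  move=> y [|->]; first exact: closed_forward_hutchinsonS.
  exact: forward_hull_id.
apply/seteqP; split => // y; apply; split; last by right.
split.
  apply: closedU; first exact: closed_closure.
  exact/accessible_closed_set1/hausdorff_accessible.
apply: (subset_trans (mimageS DC)) => z Wz.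
by left; exact: subset_closure.
Qed.

Lemma condensing_forward_hull_compact (R : realType) (X : topologicalType)
    (gamma : set X -> \bar R) (W : X -> set X) (x : X) :
  hausdorff_space X -> is_mnc gamma -> condensing gamma W ->
  gamma (mimage W (forward_hull W x)) < +oo -> compact (forward_hull W x).
Proof.
move=> hX hgamma hW; set C := forward_hull W x => fin.
have gE : gamma C = gamma (mimage W C).
  rewrite {1}/C forward_hull_eq// (mnc_setU1 hgamma).
  exact: (mnc_closure hgamma).
rewrite (closure_id C).1; last exact: (forward_hull_closed_forward W x).1.
(* Otherwise [gamma C] is positive, and finite by [gE], so condensation makes [gamma (mimage W C)]
   strictly smaller, against [gE]. *)
apply: (mnc_compact hgamma); apply: contrapT => /eqP gC0.
have gpos : 0 < gamma C by rewrite lt0e gC0 (mnc_ge0 hgamma).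
have := (hW C).1 gpos; rewrite {1}gE => /(_ fin).
by rewrite gE ltxx.
Qed.

Unset Implicit Arguments.

Theorem theorem7p15 (R : realType) (X : topologicalType)
    (gamma : set X -> \bar R) (W : X -> set X)
    (hX : hausdorff_space X)
    (hgamma : is_mnc gamma)
    (hW0 : forall x : X, W x !=set0)
    (hW : condensing gamma W)
    (hB : exists B : set X, [/\ B !=set0, closed B, mimage W B `<=` B &
                                gamma (mimage W B) < +oo]) :
  exists A : set X, minimal_invariant_set W A /\ compact A.
Proof.
have [B [[x0 Bx0] cB WB finB]] := hB.
(* [B] is itself one of the sets intersected in the hull; this carries the finiteness of [gamma]
   over from [W(B)]. *)
have CB : forward_hull W x0 `<=` B by move=> y; apply.
have cC : compact (forward_hull W x0).
  apply: (condensing_forward_hull_compact hX hgamma hW).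
  apply: le_lt_trans finB; apply: (mnc_le hgamma).
  exact: mimageS.
have [||A [AC A0 fA Amin]] :=
    compact_minimal_closed_forward (W := W) cC.
- exact: forward_hull_closed_forward.
- by exists x0; exact: forward_hull_id.
exists A; split; first exact: minimal_closed_forward_invariant.
exact: subclosed_compact fA.1 cC AC.
Qed.
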